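(* Let $R$ be a commutative unital ring, let $M,N$ be $R$-modules, let $\Omega\subseteq M_{\mathrm{nc}}$ be a right admissible nc set, and let $F\in\mathcal T^1(\Omega,\Omega;N_{\mathrm{nc}},M_{\mathrm{nc}})$ be an nc function of order $1$. Then there exists an nc function $f\in\mathcal T^0(\Omega;N_{\mathrm{nc}})$ of order $0$ such that $\Delta f=F$ if and only if ${}_0\Delta F={}_1\Delta F$. Furthermore, $f$ is uniquely determined up to a scalar matrix: if $\tilde f\in\mathcal T^0(\Omega;N_{\mathrm{nc}})$ is another nc function such that $\Delta\tilde f=F$, then there is $c\in N$ such that $\tilde f(X)=f(X)+cI_n$ for all $n\in\mathbb N$ and all $X\in\Omega_n$ (where $cI_n\in N^{n\times n}$ is the diagonal matrix with all diagonal entries $c$).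
   Context: $R$ is a commutative unital ring; matrices over $R$ multiply matrices over an $R$-module in the usual way. For an $R$-module $M$, $M_{\mathrm{nc}}=\bigsqcup_{n\ge1}M^{n\times n}$. A subset $\Omega\subseteq M_{\mathrm{nc}}$ is an nc set if $X\oplus Y=\begin{bmatrix}X&0\\ 0&Y\end{bmatrix}\in\Omega$ whenever $X,Y\in\Omega$; $\Omega_n=\Omega\cap M^{n\times n}$. It is right admissible if for all $X\in\Omega_n$, $Y\in\Omega_m$, $Z\in M^{n\times m}$ there is an invertible $r\in R$ with $\begin{bmatrix}X&rZ\\ 0&Y\end{bmatrix}\in\Omega_{n+m}$. Order 0: $f\in\mathcal T^0(\Omega;N_{\mathrm{nc}})$ means $f:\Omega\to N_{\mathrm{nc}}$, $f(\Omega_n)\subseteq N^{n\times n}$, and $f$ respects intertwinings: $SX=YS\Rightarrow Sf(X)=f(Y)S$ for $X\in\Omega_n$, $Y\in\Omega_m$, $S\in R^{m\times n}$ (equivalently, $f$ respects direct sums and similarities). Order 1: $F\in\mathcal T^1(\Omega,\Omega;N_{\mathrm{nc}},M_{\mathrm{nc}})$ means that for $X\in\Omega_n$, $Y\in\Omega_m$, $F(X,Y):M^{n\times m}\to N^{n\times m}$ is $R$-linear, and for matrices $T$ over $R$ and $Z$ over $M$ of appropriate sizes and points of $\Omega$: $TX=\tilde XT\Rightarrow TF(X,Y)(Z)=F(\tilde X,Y)(TZ)$, and $TY=\tilde YT\Rightarrow F(X,Y)(ZT)=F(X,\tilde Y)(Z)T$. Difference-differential operators ($\Omega$ right admissible).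 For $f$ of order $0$, $\Delta f$ is the nc function of order $1$ determined by $f\left(\begin{bmatrix}X&Z\\ 0&Y\end{bmatrix}\right)=\begin{bmatrix}f(X)&\Delta f(X,Y)(Z)\\ 0&f(Y)\end{bmatrix}$. For $F$ of order $1$, the bilinear-map-valued functions ${}_0\Delta F,{}_1\Delta F$ on $\Omega\times\Omega\times\Omega$ are determined by ${}_0\Delta F(X,X',Y)(Z,Z')=\begin{bmatrix}I&0\end{bmatrix}F\left(\begin{bmatrix}X&Z\\ 0&X'\end{bmatrix},Y\right)\left(\begin{bmatrix}0\\ Z'\end{bmatrix}\right)$ and ${}_1\Delta F(X,Y,Y')(Z,Z')=F\left(X,\begin{bmatrix}Y&Z'\\ 0&Y'\end{bmatrix}\right)(\begin{bmatrix}Z&0\end{bmatrix})\begin{bmatrix}0\\ I\end{bmatrix}$. These formulas are used when the block upper triangular matrix lies in $\Omega$; for a general off-diagonal block one rescales it by an invertible $r\in R$ so that the block matrix lies in $\Omega$ and then divides the result by $r$ (the result does not depend on $r$ and is linear in the off-diagonal block). *)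

(* Defs.v *)
From HB Require Import structures.
From mathcomp Require Import all_boot all_order all_algebra.
From mathcomp Require Import all_classical.

Set Implicit Arguments.
Unset Strict Implicit.
Unset Printing Implicit Defensive.

Import GRing.Theory.
Local Open Scope classical_set_scope.
Local Open Scope ring_scope.

Section ModuleMatrices.
Variables (R : comPzRingType) (M : lmodType R).

(* MathComp's [*m] and [*:] on matrices need entries in a ring; these are the
   same operations for matrices with entries in an R-module. *)
Definition lmulmx m n p (S : 'M[R]_(m, n)) (X : 'M[M]_(n, p)) : 'M[M]_(m, p) :=
  \matrix_(i, j) \sum_k S i k *: X k j.

Definition rmulmx m n p (X : 'M[M]_(m, n)) (S : 'M[R]_(n, p)) : 'M[M]_(m, p) :=
  \matrix_(i, j) \sum_k S k j *: X i k.

Definition mxscale m n (a : R) (X : 'M[M]_(m, n)) : 'M[M]_(m, n) :=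
  map_mx ( *:%R a) X.

End ModuleMatrices.

Notation "S *ml X" := (lmulmx S X) (at level 40, left associativity) : ring_scope.
Notation "X *mr S" := (rmulmx X S) (at level 40, left associativity) : ring_scope.
Notation "a *:m X" := (mxscale a X) (at level 40) : ring_scope.

Section NC.
Variables (R : comPzRingType) (M N : lmodType R).

(* A subset of M_nc is given by its levels Omega_n; M_nc only has levels
   n >= 1, hence the first conjunct. *)
Definition nc_set (Omega : forall n, set 'M[M]_n) : Prop :=
  Omega 0%N = set0 /\
  forall n m (X : 'M[M]_n) (Y : 'M[M]_m),
    Omega n X -> Omega m Y -> Omega (n + m)%N (block_mx X 0 0 Y).

(* [inv_pair r s] : r is invertible in R, with inverse s. *)
Definition inv_pair (r s : R) : Prop := r * s = 1.

Definition right_admissible (Omega : forall n, set 'M[M]_n) : Prop :=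
  forall n m (X : 'M[M]_n) (Y : 'M[M]_m) (Z : 'M[M]_(n, m)),
    Omega n X -> Omega m Y ->
    exists r s : R, inv_pair r s /\
      Omega (n + m)%N (block_mx X (r *:m Z) 0 Y).

(* Functions on Omega are total functions on all square matrices over M, whose
   values outside Omega are irrelevant: every property and every equality of
   nc functions below is restricted to points of Omega. *)
Definition fun0 := forall n, 'M[M]_n -> 'M[N]_n.
Definition fun1 :=
  forall n m, 'M[M]_n -> 'M[M]_m -> 'M[M]_(n, m) -> 'M[N]_(n, m).

Definition nc_order0 (Omega : forall n, set 'M[M]_n) (f : fun0) : Prop :=
  forall n m (X : 'M[M]_n) (Y : 'M[M]_m) (S : 'M[R]_(m, n)),
    Omega n X -> Omega m Y ->
    S *ml X = Y *mr S -> S *ml f n X = f m Y *mr S.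

Definition nc_order1 (Omega : forall n, set 'M[M]_n) (F : fun1) : Prop :=
  [/\ forall n m (X : 'M[M]_n) (Y : 'M[M]_m), Omega n X -> Omega m Y ->
        forall (a : R) (Z Z' : 'M[M]_(n, m)),
          F n m X Y (a *:m Z + Z') = a *:m F n m X Y Z + F n m X Y Z',
      forall n n' m (X : 'M[M]_n) (X' : 'M[M]_n') (Y : 'M[M]_m)
        (T : 'M[R]_(n', n)) (Z : 'M[M]_(n, m)),
        Omega n X -> Omega n' X' -> Omega m Y ->
        T *ml X = X' *mr T -> T *ml F n m X Y Z = F n' m X' Y (T *ml Z)
    & forall n m m' (X : 'M[M]_n) (Y : 'M[M]_m) (Y' : 'M[M]_m')
        (T : 'M[R]_(m', m)) (Z : 'M[M]_(n, m')),
        Omega n X -> Omega m Y -> Omega m' Y' ->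
        T *ml Y = Y' *mr T -> F n m X Y (Z *mr T) = F n m' X Y' Z *mr T].

Section Operators.
Variable Omega : forall n, set 'M[M]_n.

(* A chosen pair (r, r^-1) bringing the block matrix into Omega; by
   [DeltaE], [Delta0E] and [Delta1E] the choice does not matter. *)
Definition rescaler n m (X : 'M[M]_n) (Y : 'M[M]_m) (Z : 'M[M]_(n, m)) : R * R :=
  xget (1, 1) [set rs | inv_pair rs.1 rs.2 /\
                        Omega (block_mx X (rs.1 *:m Z) 0 Y)].

Definition Delta (f : fun0) : fun1 := fun n m X Y Z =>
  let rs := rescaler X Y Z in
  rs.2 *:m ursubmx (f (n + m)%N (block_mx X (rs.1 *:m Z) 0 Y)).

Definition Delta0 (F : fun1) n0 n1 n2 (X0 : 'M[M]_n0) (X1 : 'M[M]_n1)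
    (X2 : 'M[M]_n2) (Z1 : 'M[M]_(n0, n1)) (Z2 : 'M[M]_(n1, n2)) :
    'M[N]_(n0, n2) :=
  let rs := rescaler X0 X1 Z1 in
  rs.2 *:m (row_mx 1%:M 0 *ml
            F (n0 + n1)%N n2 (block_mx X0 (rs.1 *:m Z1) 0 X1) X2 (col_mx 0 Z2)).

Definition Delta1 (F : fun1) n0 n1 n2 (X0 : 'M[M]_n0) (X1 : 'M[M]_n1)
    (X2 : 'M[M]_n2) (Z1 : 'M[M]_(n0, n1)) (Z2 : 'M[M]_(n1, n2)) :
    'M[N]_(n0, n2) :=
  let rs := rescaler X1 X2 Z2 in
  rs.2 *:m (F n0 (n1 + n2)%N X0 (block_mx X1 (rs.1 *:m Z2) 0 X2) (row_mx Z1 0)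
            *mr col_mx 0 1%:M).

End Operators.
End NC.

Section Facts.
Variables (R : comPzRingType).

Section Algebra.
Variable V : lmodType R.

Lemma mxscaleA m n a b (X : 'M[V]_(m, n)) : a *:m (b *:m X) = (a * b) *:m X.
Proof. by apply/matrixP => i j; rewrite !mxE scalerA. Qed.

Lemma mxscale1 m n (X : 'M[V]_(m, n)) : 1 *:m X = X.
Proof. by apply/matrixP => i j; rewrite !mxE scale1r. Qed.

Lemma mxscale0 m n a : a *:m (0 : 'M[V]_(m, n)) = 0.
Proof. by apply/matrixP => i j; rewrite !mxE scaler0. Qed.

Lemma lmul_scalar m n a (X : 'M[V]_(m, n)) : a%:M *ml X = a *:m X.
Proof.
apply/matrixP => i j; rewrite !mxE (bigD1 i) //= mxE eqxx mulr1n big1 ?addr0 //.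
by move=> k /negPf ki; rewrite mxE eq_sym ki mulr0n scale0r.
Qed.

Lemma rmul_scalar m n a (X : 'M[V]_(m, n)) : X *mr a%:M = a *:m X.
Proof.
apply/matrixP => i j; rewrite !mxE (bigD1 j) //= mxE eqxx mulr1n big1 ?addr0 //.
by move=> k /negPf ki; rewrite mxE ki mulr0n scale0r.
Qed.

Lemma lmul0 m n p (X : 'M[V]_(n, p)) : (0 : 'M[R]_(m, n)) *ml X = 0.
Proof. by apply/matrixP => i j; rewrite !mxE big1 // => k; rewrite mxE scale0r. Qed.

Lemma lmulr0 m n p (S : 'M[R]_(m, n)) : S *ml (0 : 'M[V]_(n, p)) = 0.
Proof. by apply/matrixP => i j; rewrite !mxE big1 // => k; rewrite mxE scaler0. Qed.

Lemma rmul0 m n p (X : 'M[V]_(m, n)) : X *mr (0 : 'M[R]_(n, p)) = 0.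
Proof. by apply/matrixP => i j; rewrite !mxE big1 // => k; rewrite mxE scale0r. Qed.

Lemma rmull0 m n p (S : 'M[R]_(n, p)) : (0 : 'M[V]_(m, n)) *mr S = 0.
Proof. by apply/matrixP => i j; rewrite !mxE big1 // => k; rewrite mxE scaler0. Qed.

Lemma lmul_row_col m n1 n2 p (A : 'M[R]_(m, n1)) (B : 'M[R]_(m, n2))
    (X : 'M[V]_(n1, p)) (Y : 'M[V]_(n2, p)) :
  row_mx A B *ml col_mx X Y = A *ml X + B *ml Y.
Proof.
apply/matrixP => i j; rewrite !mxE big_split_ord /=.
by congr (_ + _); apply: eq_bigr => k _;
   rewrite ?row_mxEl ?row_mxEr ?col_mxEu ?col_mxEd.
Qed.

Lemma rmul_row_col m n1 n2 p (A : 'M[V]_(m, n1)) (B : 'M[V]_(m, n2))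
    (X : 'M[R]_(n1, p)) (Y : 'M[R]_(n2, p)) :
  row_mx A B *mr col_mx X Y = A *mr X + B *mr Y.
Proof.
apply/matrixP => i j; rewrite !mxE big_split_ord /=.
by congr (_ + _); apply: eq_bigr => k _;
   rewrite ?row_mxEl ?row_mxEr ?col_mxEu ?col_mxEd.
Qed.

Lemma lmul_col m1 m2 n p (A : 'M[R]_(m1, n)) (B : 'M[R]_(m2, n))
    (X : 'M[V]_(n, p)) : col_mx A B *ml X = col_mx (A *ml X) (B *ml X).
Proof.
apply/matrixP => i j; rewrite -[i]fintype.splitK.
by case: (fintype.split i) => k /=; rewrite ?col_mxEu ?col_mxEd !mxE; apply: eq_bigr => l _;
   rewrite ?col_mxEu ?col_mxEd.
Qed.

Lemma rmul_col m1 m2 n p (A : 'M[V]_(m1, n)) (B : 'M[V]_(m2, n))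
    (X : 'M[R]_(n, p)) : col_mx A B *mr X = col_mx (A *mr X) (B *mr X).
Proof.
apply/matrixP => i j; rewrite -[i]fintype.splitK.
by case: (fintype.split i) => k /=; rewrite ?col_mxEu ?col_mxEd !mxE; apply: eq_bigr => l _;
   rewrite ?col_mxEu ?col_mxEd.
Qed.

Lemma lmul_row m n p1 p2 (A : 'M[R]_(m, n)) (X : 'M[V]_(n, p1))
    (Y : 'M[V]_(n, p2)) : A *ml row_mx X Y = row_mx (A *ml X) (A *ml Y).
Proof.
apply/matrixP => i j; rewrite -[j]fintype.splitK.
by case: (fintype.split j) => k /=; rewrite ?row_mxEl ?row_mxEr !mxE; apply: eq_bigr => l _;
   rewrite ?row_mxEl ?row_mxEr.
Qed.

Lemma rmul_row m n p1 p2 (A : 'M[V]_(m, n)) (X : 'M[R]_(n, p1))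
    (Y : 'M[R]_(n, p2)) : A *mr row_mx X Y = row_mx (A *mr X) (A *mr Y).
Proof.
apply/matrixP => i j; rewrite -[j]fintype.splitK.
by case: (fintype.split j) => k /=; rewrite ?row_mxEl ?row_mxEr !mxE; apply: eq_bigr => l _;
   rewrite ?row_mxEl ?row_mxEr.
Qed.

Lemma lmul_block m1 m2 n1 n2 p1 p2
    (A : 'M[R]_(m1, n1)) B C (D : 'M[R]_(m2, n2))
    (X : 'M[V]_(n1, p1)) Y Z (W : 'M[V]_(n2, p2)) :
  block_mx A B C D *ml block_mx X Y Z W =
  block_mx (A *ml X + B *ml Z) (A *ml Y + B *ml W)
           (C *ml X + D *ml Z) (C *ml Y + D *ml W).
Proof.
by rewrite !block_mxEv lmul_col -!block_mxEv !block_mxEh !lmul_row !lmul_row_col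
           -!block_mxEh block_mxEv.
Qed.

Lemma rmul_block m1 m2 n1 n2 p1 p2
    (A : 'M[V]_(m1, n1)) B C (D : 'M[V]_(m2, n2))
    (X : 'M[R]_(n1, p1)) Y Z (W : 'M[R]_(n2, p2)) :
  block_mx A B C D *mr block_mx X Y Z W =
  block_mx (A *mr X + B *mr Z) (A *mr Y + B *mr W)
           (C *mr X + D *mr Z) (C *mr Y + D *mr W).
Proof.
by rewrite !block_mxEv rmul_col -!block_mxEv !block_mxEh !rmul_row !rmul_row_col
           -!block_mxEh block_mxEv.
Qed.

Lemma diag_intertwine n m (X : 'M[V]_n) (Y : 'M[V]_m) (Z : 'M[V]_(n, m)) (r r' : R) :
  block_mx r'%:M 0 0 r%:M *ml block_mx X (r *:m Z) 0 Y =
  block_mx X (r' *:m Z) 0 Y *mr block_mx r'%:M 0 0 r%:M.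
Proof.
rewrite lmul_block rmul_block !lmul0 !rmul0 !rmull0 !lmulr0 !add0r !addr0.
by rewrite !lmul_scalar !rmul_scalar !mxscaleA mulrC.
Qed.

Lemma mxscale_cancel m n (r s r' s' : R) (A B : 'M[V]_(m, n)) :
  r * s = 1 -> r' * s' = 1 -> r' *:m A = r *:m B -> s *:m A = s' *:m B.
Proof.
move=> rs rs' AB; have := congr1 (mxscale (s * s')) AB.
rewrite !mxscaleA -mulrA [s' * r']mulrC rs' mulr1 => ->.
by rewrite mulrAC [s * r]mulrC rs mul1r.
Qed.

End Algebra.

Variables (M N : lmodType R) (Omega : forall n, set 'M[M]_n).
Hypothesis ra : right_admissible Omega.

Lemma rescalerP n m (X : 'M[M]_n) (Y : 'M[M]_m) (Z : 'M[M]_(n, m)) :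
  Omega X -> Omega Y ->
  inv_pair (rescaler Omega X Y Z).1 (rescaler Omega X Y Z).2 /\
  Omega (block_mx X ((rescaler Omega X Y Z).1 *:m Z) 0 Y).
Proof.
move=> OX OY; have [r [s H]] := ra Z OX OY.
by rewrite /rescaler; case: xgetP => [rs _ //|/(_ (r, s))/(_ H)].
Qed.

Lemma order0_block (f : fun0 M N) : nc_order0 Omega f ->
  forall n m (X : 'M[M]_n) (Y : 'M[M]_m) (Z : 'M[M]_(n, m)),
  Omega X -> Omega Y -> Omega (block_mx X Z 0 Y) ->
  f _ (block_mx X Z 0 Y) =
  block_mx (f _ X) (ursubmx (f _ (block_mx X Z 0 Y))) 0 (f _ Y).
Proof.
move=> hf n m X Y Z OX OY OB; set B := block_mx X Z 0 Y.
have h1 : col_mx 1%:M 0 *ml f _ X = f _ B *mr col_mx 1%:M 0.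
  apply: hf => //; rewrite lmul_col /B block_mxEh rmul_row_col.
  by rewrite rmul0 addr0 lmul0 lmul_scalar rmul_scalar !mxscale1.
have h2 : row_mx 0 1%:M *ml f _ B = f _ Y *mr row_mx 0 1%:M.
  apply: hf => //; rewrite /B block_mxEv lmul_row_col rmul_row.
  by rewrite rmul0 lmul0 add0r lmul_scalar rmul_scalar !mxscale1.
move: h1 h2; rewrite -(submxK (f _ B)) block_mxKur.
rewrite lmul_col lmul_scalar lmul0 mxscale1 {1}block_mxEh rmul_row_col rmul0 addr0.
rewrite rmul_scalar mxscale1 => /eq_col_mx[-> ->].
rewrite block_mxEv lmul_row_col lmul0 add0r lmul_scalar mxscale1.
by rewrite rmul_row rmul_scalar rmul0 mxscale1 => /eq_row_mx[_ ->].
Qed.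

Lemma DeltaE (f : fun0 M N) : nc_order0 Omega f ->
  forall n m (X : 'M[M]_n) (Y : 'M[M]_m) (Z : 'M[M]_(n, m)) (r s : R),
  Omega X -> Omega Y -> inv_pair r s -> Omega (block_mx X (r *:m Z) 0 Y) ->
  f _ (block_mx X (r *:m Z) 0 Y) =
  block_mx (f _ X) (r *:m Delta Omega f X Y Z) 0 (f _ Y).
Proof.
move=> hf n m X Y Z r s OX OY rs OB; rewrite (order0_block hf) //.
suff -> : ursubmx (f _ (block_mx X (r *:m Z) 0 Y)) = r *:m Delta Omega f X Y Z by [].
rewrite /Delta; have [] := rescalerP Z OX OY.
case: (rescaler _ _ _ _) => r' s' /= rs' OB'.
have /(hf _ _ _ _ _ OB OB') := diag_intertwine X Y Z r r'.
rewrite (order0_block hf OX OY OB) (order0_block hf OX OY OB').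
rewrite lmul_block rmul_block !lmul0 !rmul0 !addr0 !add0r.
case/eq_block_mx => _; rewrite !lmul_scalar !rmul_scalar => h _ _.
rewrite !block_mxKur -(mxscale_cancel rs rs' h) mxscaleA rs mxscale1 //.
Qed.

Lemma Delta0E (F : fun1 M N) : nc_order1 Omega F ->
  forall n0 n1 n2 (X0 : 'M[M]_n0) (X1 : 'M[M]_n1) (X2 : 'M[M]_n2)
    (Z1 : 'M[M]_(n0, n1)) (Z2 : 'M[M]_(n1, n2)) (r s : R),
  Omega X0 -> Omega X1 -> Omega X2 ->
  inv_pair r s -> Omega (block_mx X0 (r *:m Z1) 0 X1) ->
  Delta0 Omega F X0 X1 X2 Z1 Z2 =
  s *:m (row_mx 1%:M 0 *ml F _ _ (block_mx X0 (r *:m Z1) 0 X1) X2 (col_mx 0 Z2)).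
Proof.
move=> [Flin Fl _] n0 n1 n2 X0 X1 X2 Z1 Z2 r s O0 O1 O2 rs OB; rewrite /Delta0.
have [] := rescalerP Z1 O0 O1.
case: (rescaler _ _ _ _) => r' s' /= rs' OB'.
have /(Fl _ _ _ _ _ _ _ (col_mx 0 Z2) OB OB' O2) := diag_intertwine X0 X1 Z1 r r'.
set A := F _ _ _ _ _; set B := F _ _ (block_mx _ (r' *:m _) _ _) _ (col_mx 0 Z2).
have -> : block_mx r'%:M 0 0 r%:M *ml col_mx (0 : 'M[M]_(n0, n2)) Z2 = r *:m col_mx 0 Z2 + 0.
  rewrite block_mxEv lmul_col !lmul_row_col !lmul0 !lmulr0 !add0r lmul_scalar addr0.
  by rewrite /mxscale map_col_mx -/(mxscale r 0) mxscale0.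
rewrite Flin // -/B.
have -> : F _ _ (block_mx X0 (r' *:m Z1) 0 X1) X2 0 = 0.
  have := Flin _ _ _ _ OB' O2 1 0 0.
  by rewrite !mxscale1 addr0 => /eqP; rewrite -subr_eq subrr eq_sym => /eqP.
rewrite addr0 -(vsubmxK A) -(vsubmxK B) /mxscale map_col_mx -!/(mxscale _ _).
rewrite block_mxEv lmul_col !lmul_row_col !lmul0 addr0 => /eq_col_mx[h _].
rewrite !addr0 !lmul_scalar !mxscale1; rewrite lmul_scalar in h.
exact/esym/(mxscale_cancel rs rs' h).
Qed.

Lemma Delta1E (F : fun1 M N) : nc_order1 Omega F ->
  forall n0 n1 n2 (X0 : 'M[M]_n0) (X1 : 'M[M]_n1) (X2 : 'M[M]_n2)
    (Z1 : 'M[M]_(n0, n1)) (Z2 : 'M[M]_(n1, n2)) (r s : R),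
  Omega X0 -> Omega X1 -> Omega X2 ->
  inv_pair r s -> Omega (block_mx X1 (r *:m Z2) 0 X2) ->
  Delta1 Omega F X0 X1 X2 Z1 Z2 =
  s *:m (F _ _ X0 (block_mx X1 (r *:m Z2) 0 X2) (row_mx Z1 0) *mr col_mx 0 1%:M).
Proof.
move=> [Flin _ Fr] n0 n1 n2 X0 X1 X2 Z1 Z2 r s O0 O1 O2 rs OB; rewrite /Delta1.
have [] := rescalerP Z2 O1 O2.
case: (rescaler _ _ _ _) => r' s' /= rs' OB'.
have /(Fr _ _ _ _ _ _ _ (row_mx Z1 0) O0 OB OB') := diag_intertwine X1 X2 Z2 r r'.
set B := F _ _ _ (block_mx _ (r' *:m _) _ _) (row_mx Z1 0).
set A := F _ _ _ (block_mx _ (r *:m _) _ _) (row_mx Z1 0).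
have -> : row_mx Z1 (0 : 'M[M]_(n0, n2)) *mr block_mx r'%:M 0 0 r%:M = r' *:m row_mx Z1 0 + 0.
  rewrite block_mxEh rmul_row !rmul_row_col !rmul0 !rmull0 !addr0 rmul_scalar.
  by rewrite /mxscale map_row_mx -/(mxscale r' 0) mxscale0.
rewrite Flin // -/A.
have -> : F _ _ X0 (block_mx X1 (r *:m Z2) 0 X2) 0 = 0.
  have := Flin _ _ _ _ O0 OB 1 0 0.
  by rewrite !mxscale1 addr0 => /eqP; rewrite -subr_eq subrr eq_sym => /eqP.
rewrite addr0 -(hsubmxK A) -(hsubmxK B) /mxscale map_row_mx -!/(mxscale _ _).
rewrite block_mxEh rmul_row !rmul_row_col !rmul0 add0r => /eq_row_mx[_ h].
rewrite !add0r !rmul_scalar !mxscale1; rewrite rmul_scalar in h.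
exact/esym/(mxscale_cancel rs rs' h).
Qed.

End Facts.

(* Main.v *)
(** The operator [Delta] is governed by the difference formula
    [f(X) S - S f(Y) = Delta f (X, Y) (X S - S Y)] for every rectangular scalar
    matrix [S]; conversely this formula alone forces [f] to be nc with
    [Delta f = F].  On the commutators [X S - S Y] the condition
    [Delta0 F = Delta1 F] says that [D_{X,Y}(S) = F(X, Y)(X S - S Y)] obeys the
    Leibniz rule [D_{X,Z}(S T) = D_{X,Y}(S) T + S D_{Y,Z}(T)], and a derivation
    on rectangular matrices is inner: with a base point [Y] in [Omega],
    [f(X) = \sum_j D_{X,Y}(E_{j1}) E_{1j}].  Necessity follows by applying the
    difference formula to [S = [0 0; I 0]] between two block triangular
    points. *)
Require Import Defs.
From mathcomp Require Import all_boot all_order all_algebra.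
From mathcomp Require Import all_classical.
Set Implicit Arguments.
Unset Strict Implicit.
Unset Printing Implicit Defensive.
Import GRing.Theory.
Local Open Scope classical_set_scope.
Local Open Scope ring_scope.

(** * Bimodule calculus of scalar matrices acting on module matrices *)

Section ModuleMatrixAlgebra.
Variables (R : comPzRingType) (V : lmodType R).

Lemma mxscaleDr m n a (X Y : 'M[V]_(m, n)) : a *:m (X + Y) = a *:m X + a *:m Y.
Proof. by apply/matrixP => i j; rewrite !mxE scalerDr. Qed.

Lemma mxscaleNr m n a (X : 'M[V]_(m, n)) : a *:m (- X) = - (a *:m X).
Proof. by apply/matrixP => i j; rewrite !mxE scalerN. Qed.

Lemma mxscaleBr m n a (X Y : 'M[V]_(m, n)) : a *:m (X - Y) = a *:m X - a *:m Y.
Proof. by rewrite mxscaleDr mxscaleNr. Qed.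

Lemma mxscale_eqr m n (r s : R) (X Y : 'M[V]_(m, n)) :
  r * s = 1 -> r *:m X = Y -> X = s *:m Y.
Proof. by move=> rs <-; rewrite mxscaleA mulrC rs mxscale1. Qed.

Lemma mxBE m n (X Y : 'M[V]_(m, n)) i j : (X - Y) i j = X i j - Y i j.
Proof. by rewrite !mxE. Qed.

Lemma lmulmxDr m n p (S : 'M[R]_(m, n)) (X Y : 'M[V]_(n, p)) :
  S *ml (X + Y) = S *ml X + S *ml Y.
Proof.
apply/matrixP => i j; rewrite !mxE -big_split; apply: eq_bigr => k _.
by rewrite mxE scalerDr.
Qed.

Lemma rmulmxDl m n p (S : 'M[R]_(n, p)) (X Y : 'M[V]_(m, n)) :
  (X + Y) *mr S = X *mr S + Y *mr S.
Proof.
apply/matrixP => i j; rewrite !mxE -big_split; apply: eq_bigr => k _.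
by rewrite mxE scalerDr.
Qed.

Lemma lmulmxNr m n p (S : 'M[R]_(m, n)) (X : 'M[V]_(n, p)) :
  S *ml (- X) = - (S *ml X).
Proof.
by apply/matrixP => i j; rewrite !mxE -sumrN; apply: eq_bigr => k _;
   rewrite mxE scalerN.
Qed.

Lemma rmulmxNl m n p (S : 'M[R]_(n, p)) (X : 'M[V]_(m, n)) :
  (- X) *mr S = - (X *mr S).
Proof.
by apply/matrixP => i j; rewrite !mxE -sumrN; apply: eq_bigr => k _;
   rewrite mxE scalerN.
Qed.

Lemma lmulmxZl m n p a (S : 'M[R]_(m, n)) (X : 'M[V]_(n, p)) :
  (a *: S) *ml X = a *:m (S *ml X).
Proof.
by apply/matrixP => i j; rewrite !mxE scaler_sumr; apply: eq_bigr => k _;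
   rewrite mxE scalerA.
Qed.

Lemma rmulmxZr m n p a (S : 'M[R]_(n, p)) (X : 'M[V]_(m, n)) :
  X *mr (a *: S) = a *:m (X *mr S).
Proof.
by apply/matrixP => i j; rewrite !mxE scaler_sumr; apply: eq_bigr => k _;
   rewrite mxE scalerA.
Qed.

Lemma lmulmxA m n p q (S : 'M[R]_(m, n)) (T : 'M[R]_(n, p)) (X : 'M[V]_(p, q)) :
  S *ml (T *ml X) = (S *m T) *ml X.
Proof.
apply/matrixP => i j; rewrite !mxE.
under eq_bigr => k _ do rewrite mxE scaler_sumr.
rewrite exchange_big; apply: eq_bigr => l _; rewrite mxE scaler_suml.
by apply: eq_bigr => k _; rewrite scalerA.
Qed.

Lemma rmulmxA m n p q (X : 'M[V]_(m, n)) (S : 'M[R]_(n, p)) (T : 'M[R]_(p, q)) :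
  X *mr S *mr T = X *mr (S *m T).
Proof.
apply/matrixP => i j; rewrite !mxE.
under eq_bigr => k _ do rewrite mxE scaler_sumr.
rewrite exchange_big; apply: eq_bigr => l _; rewrite mxE scaler_suml.
by apply: eq_bigr => k _; rewrite scalerA mulrC.
Qed.

Lemma lrmulmxA m n p q (S : 'M[R]_(m, n)) (X : 'M[V]_(n, p)) (T : 'M[R]_(p, q)) :
  S *ml X *mr T = S *ml (X *mr T).
Proof.
apply/matrixP => i j; rewrite !mxE.
under eq_bigr => k _ do rewrite mxE scaler_sumr.
rewrite exchange_big; apply: eq_bigr => l _; rewrite mxE scaler_sumr.
by apply: eq_bigr => k _; rewrite !scalerA mulrC.
Qed.

Lemma lmulmxDl m n p (S T : 'M[R]_(m, n)) (X : 'M[V]_(n, p)) :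
  (S + T) *ml X = S *ml X + T *ml X.
Proof.
apply/matrixP => i j; rewrite !mxE -big_split; apply: eq_bigr => k _.
by rewrite mxE scalerDl.
Qed.

Lemma rmulmxDr m n p (X : 'M[V]_(m, n)) (S T : 'M[R]_(n, p)) :
  X *mr (S + T) = X *mr S + X *mr T.
Proof.
apply/matrixP => i j; rewrite !mxE -big_split; apply: eq_bigr => k _.
by rewrite mxE scalerDl.
Qed.

Lemma mulmx_delta m n p (S : 'M[R]_(m, n)) (k : 'I_n) (l : 'I_p) :
  S *m delta_mx k l = \sum_j S j k *: delta_mx j l.
Proof.
apply/matrixP => a b; rewrite mxE summxE (bigD1 k) //= big1 ?addr0; last first.
  by move=> h /negPf hk; rewrite mxE hk mulr0.
rewrite (bigD1 a) //= big1 ?addr0 => [|h /negPf ha]; last first.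
  by rewrite !mxE eq_sym ha mulr0.
by rewrite !mxE !eqxx.
Qed.

Lemma rmul_delta m n p (X : 'M[V]_(m, n)) (i : 'I_n) (j : 'I_p) k :
  (X *mr delta_mx i j) k j = X k i.
Proof.
rewrite mxE (bigD1 i) //= big1 ?addr0 => [|l /negPf li]; last first.
  by rewrite mxE li scale0r.
by rewrite mxE !eqxx scale1r.
Qed.

Lemma lmul_delta m n p (X : 'M[V]_(m, n)) (i : 'I_p) (j : 'I_m) k l :
  (delta_mx i j *ml X) k l = X j l *+ (k == i).
Proof.
rewrite mxE (bigD1 j) //= big1 ?addr0 => [|h /negPf hj]; last first.
  by rewrite mxE hj andbF scale0r.
by rewrite mxE eqxx andbT; case: (k == i); rewrite ?scale1r ?scale0r.
Qed.

Lemma mxscale_row m n1 n2 a (X : 'M[V]_(m, n1)) (Y : 'M[V]_(m, n2)) :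
  a *:m row_mx X Y = row_mx (a *:m X) (a *:m Y).
Proof. exact: map_row_mx. Qed.

Lemma mxscale_col m1 m2 n a (X : 'M[V]_(m1, n)) (Y : 'M[V]_(m2, n)) :
  a *:m col_mx X Y = col_mx (a *:m X) (a *:m Y).
Proof. exact: map_col_mx. Qed.

Lemma row_mx10_lmul n m p (X : 'M[V]_(n + m, p)) :
  (row_mx 1%:M 0 : 'M[R]_(n, n + m)) *ml X = usubmx X.
Proof.
by rewrite -{1}(vsubmxK X) lmul_row_col lmul0 addr0 lmul_scalar mxscale1.
Qed.

Lemma rmul_col_mx01 n m p (X : 'M[V]_(p, n + m)) :
  X *mr (col_mx 0 1%:M : 'M[R]_(n + m, m)) = rsubmx X.
Proof.
by rewrite -{1}(hsubmxK X) rmul_row_col rmul0 add0r rmul_scalar mxscale1.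
Qed.

(** * Intertwinings between block triangular points and their diagonal blocks *)

Lemma block_row_intertwine n m (X : 'M[V]_n) (Y : 'M[V]_m) Z :
  row_mx 0 1%:M *ml block_mx X Z 0 Y = Y *mr (row_mx 0 1%:M : 'M[R]_(m, n + m)).
Proof.
by rewrite block_mxEv lmul_row_col rmul_row lmul0 add0r rmul0 lmul_scalar rmul_scalar
           !mxscale1.
Qed.

Lemma block_col_intertwine n m (X : 'M[V]_n) (Y : 'M[V]_m) Z :
  (col_mx 1%:M 0 : 'M[R]_(n + m, n)) *ml X = block_mx X Z 0 Y *mr col_mx 1%:M 0.
Proof.
by rewrite block_mxEh rmul_row_col lmul_col lmul0 rmul0 addr0 lmul_scalar rmul_scalar
           !mxscale1.
Qed.

(** The unipotent matrix with off-diagonal block [r *: S] conjugates this triangular point to the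
    direct sum of [X] and [Y]; the present row is its top one. Scaling [S] by the same [r] as the
    commutator keeps the identity valid for rescaled points. *)
Lemma commutator_row_intertwine n m (X : 'M[V]_n) (Y : 'M[V]_m) (S : 'M[R]_(n, m)) r :
  row_mx 1%:M (r *: S) *ml block_mx X (r *:m (X *mr S - S *ml Y)) 0 Y =
  X *mr row_mx 1%:M (r *: S).
Proof.
rewrite block_mxEv lmul_row_col !lmul_row add_row_mx rmul_row !lmul_scalar.
by rewrite rmul_scalar !mxscale1 lmulr0 addr0 lmulmxZl rmulmxZr mxscaleBr subrK.
Qed.

(** The column is the last one of the inverse of that unipotent matrix, hence the sign. *)
Lemma commutator_col_intertwine n m (X : 'M[V]_n) (Y : 'M[V]_m) (S : 'M[R]_(n, m)) r :
  col_mx (- r *: S) 1%:M *ml Y =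
  block_mx X (r *:m (X *mr S - S *ml Y)) 0 Y *mr col_mx (- r *: S) 1%:M.
Proof.
rewrite block_mxEh rmul_row_col !rmul_col add_col_mx lmul_col !rmul_scalar.
rewrite lmul_scalar !mxscale1 rmull0 add0r lmulmxZl rmulmxZr mxscaleBr.
congr col_mx; apply/matrixP => i j; rewrite !mxE !scaleNr addrA.
by rewrite addNr add0r.
Qed.

End ModuleMatrixAlgebra.

(** * Difference formula, and the values of [Delta0 F] and [Delta1 F] on commutators *)

Section Integration.
Variables (R : comPzRingType) (M N : lmodType R).
Variables (Omega : forall n, set 'M[M]_n).
Hypothesis hadm : right_admissible Omega.

Definition difference_formula (f : fun0 M N) (F : fun1 M N) : Prop :=
  forall n m (X : 'M[M]_n) (Y : 'M[M]_m) (S : 'M[R]_(n, m)),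
    Omega X -> Omega Y ->
    f _ X *mr S - S *ml f _ Y = F _ _ X Y (X *mr S - S *ml Y).

Lemma Delta_difference (f : fun0 M N) :
  nc_order0 Omega f -> difference_formula f (Delta Omega f).
Proof.
move=> hf n m X Y S OX OY; set Z := X *mr S - S *ml Y.
have [r [s [rs OB]]] := hadm Z OX OY.
have : row_mx 1%:M (r *: S) *ml f _ (block_mx X (r *:m Z) 0 Y) =
       f _ X *mr row_mx 1%:M (r *: S).
  by apply: hf => //; apply: commutator_row_intertwine.
rewrite (DeltaE hadm hf OX OY rs OB) block_mxEv lmul_row_col !lmul_row.
rewrite add_row_mx rmul_row => /eq_row_mx[_].
rewrite lmul_scalar mxscale1 lmulmxZl rmulmxZr => e.
(* Here [e] is the second block of the row, [r] times the difference formula; multiplying by [s]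
   removes the factor. *)
by rewrite [LHS](mxscale_eqr rs (mxscaleBr _ _ _)) -e addrK mxscaleA mulrC rs mxscale1.
Qed.

Variable F : fun1 M N.
Hypothesis hF : nc_order1 Omega F.

Section AtPoints.
Variables (n m : nat) (X : 'M[M]_n) (Y : 'M[M]_m).
Hypotheses (OX : Omega X) (OY : Omega Y).

Lemma order1D Z Z' : F X Y (Z + Z') = F X Y Z + F X Y Z'.
Proof.
by case: hF => lin _ _; have := lin _ _ _ _ OX OY 1 Z Z'; rewrite !mxscale1.
Qed.

Lemma order1_0 : F X Y 0 = 0.
Proof. by apply: (addIr (F X Y 0)); rewrite -order1D !add0r. Qed.

Lemma order1Z a Z : F X Y (a *:m Z) = a *:m F X Y Z.
Proof.
by case: hF => lin _ _; have := lin _ _ _ _ OX OY a Z 0; rewrite order1_0 !addr0.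
Qed.

Lemma order1N Z : F X Y (- Z) = - F X Y Z.
Proof. by apply: (addIr (F X Y Z)); rewrite -order1D !addNr order1_0. Qed.

End AtPoints.

(** The row [[0 I]] intertwines the block point with [X1] and sends the column to [Z2]. So the upper
    block, which [Delta0] extracts, is the only new information in this value of [F]. *)
Lemma order1_block_col n0 n1 n2 (X0 : 'M[M]_n0) (X1 : 'M[M]_n1) (X2 : 'M[M]_n2)
    (Z1 : 'M[M]_(n0, n1)) (Z2 : 'M[M]_(n1, n2)) :
  Omega X0 -> Omega X1 -> Omega X2 -> Omega (block_mx X0 Z1 0 X1) ->
  dsubmx (F (block_mx X0 Z1 0 X1) X2 (col_mx 0 Z2)) = F X1 X2 Z2.
Proof.
move=> O0 O1 O2 OB; have [_ Fl _] := hF.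
have := Fl _ _ _ _ _ _ _ (col_mx 0 Z2) OB O1 O2 (block_row_intertwine X0 X1 Z1).
set G := F _ _ _; rewrite -{1}(vsubmxK G) !lmul_row_col !lmul0 !add0r.
by rewrite !lmul_scalar !mxscale1.
Qed.

Lemma order1_block_row n0 n1 n2 (X0 : 'M[M]_n0) (X1 : 'M[M]_n1) (X2 : 'M[M]_n2)
    (Z1 : 'M[M]_(n0, n1)) (Z2 : 'M[M]_(n1, n2)) :
  Omega X0 -> Omega X1 -> Omega X2 -> Omega (block_mx X1 Z2 0 X2) ->
  lsubmx (F X0 (block_mx X1 Z2 0 X2) (row_mx Z1 0)) = F X0 X1 Z1.
Proof.
move=> O0 O1 O2 OB; have [_ _ Fr] := hF.
have := Fr _ _ _ _ _ _ _ (row_mx Z1 0) O0 O1 OB (block_col_intertwine X1 X2 Z2).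
set G := F _ _ (row_mx _ _); rewrite -{1}(hsubmxK G) !rmul_row_col !rmul0 !addr0.
by rewrite !rmul_scalar !mxscale1.
Qed.

(** The row [[I rS]] intertwines the block point with [X0] and turns the column with blocks [0],
    [Z2] into [r S Z2]. Since the lower block of the value of [F] is already known, the upper one
    can be solved for without any block point. *)
Lemma Delta0_commutator n0 n1 n2 (X0 : 'M[M]_n0) (X1 : 'M[M]_n1) (X2 : 'M[M]_n2)
    (S : 'M[R]_(n0, n1)) (Z2 : 'M[M]_(n1, n2)) :
  Omega X0 -> Omega X1 -> Omega X2 ->
  Delta0 Omega F X0 X1 X2 (X0 *mr S - S *ml X1) Z2 =
  F X0 X2 (S *ml Z2) - S *ml F X1 X2 Z2.
Proof.
move=> O0 O1 O2; set Z1 := X0 *mr S - S *ml X1.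
have [r [s [rs OB]]] := hadm Z1 O0 O1; have [_ Fl _] := hF.
rewrite (Delta0E hadm hF _ O0 O1 O2 rs OB).
have := Fl _ _ _ _ _ _ _ (col_mx 0 Z2) OB O0 O2 (commutator_row_intertwine X0 X1 S r).
have := order1_block_col Z2 O0 O1 O2 OB.
set G := F _ _ (col_mx _ _) => Gd; rewrite -(vsubmxK G) Gd !lmul_row_col.
rewrite lmul0 lmulr0 add0r addr0 lmul_scalar mxscale1 !lmulmxZl order1Z // => e.
by apply/esym/(mxscale_eqr rs); rewrite mxscaleBr -e addrK.
Qed.

Lemma Delta1_commutator n0 n1 n2 (X0 : 'M[M]_n0) (X1 : 'M[M]_n1) (X2 : 'M[M]_n2)
    (Z1 : 'M[M]_(n0, n1)) (T : 'M[R]_(n1, n2)) :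
  Omega X0 -> Omega X1 -> Omega X2 ->
  Delta1 Omega F X0 X1 X2 Z1 (X1 *mr T - T *ml X2) =
  F X0 X1 Z1 *mr T - F X0 X2 (Z1 *mr T).
Proof.
move=> O0 O1 O2; set Z2 := X1 *mr T - T *ml X2.
have [r [s [rs OB]]] := hadm Z2 O1 O2; have [_ _ Fr] := hF.
rewrite (Delta1E hadm hF _ O0 O1 O2 rs OB).
(* The column with blocks [-rT], [I] sends [[Z1 0]] to [-r Z1 T]; the left block of the value of [F]
   is known, so the right one is determined. *)
have := Fr _ _ _ _ _ _ _ (row_mx Z1 0) O0 O2 OB (commutator_col_intertwine X1 X2 T r).
have := order1_block_row Z1 O0 O1 O2 OB.
set G := F _ _ (row_mx _ _) => Gl; rewrite -(hsubmxK G) Gl !rmul_row_col.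
rewrite rmul0 rmull0 add0r addr0 rmul_scalar mxscale1 !rmulmxZr order1Z //.
have mxN k l (A : 'M[N]_(k, l)) : (- r) *:m A = - (r *:m A).
  by apply/matrixP => i j; rewrite !mxE scaleNr.
rewrite !mxN => e; apply/esym/(mxscale_eqr rs); rewrite mxscaleBr.
by rewrite e addNKr.
Qed.

(** * Passing between [Delta f = F] and the difference formula *)

Lemma difference_formula_Delta (f : fun0 M N) :
  nc_order0 Omega f ->
  (forall n m (X : 'M[M]_n) (Y : 'M[M]_m) (Z : 'M[M]_(n, m)),
    Omega X -> Omega Y -> Delta Omega f X Y Z = F X Y Z) ->
  difference_formula f F.
Proof.
by move=> hf fF n m X Y S OX OY; rewrite -fF //; apply: Delta_difference.
Qed.

(** For an intertwiner the commutator vanishes, and [F] sends zero to zero. *)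
Lemma difference_formula_order0 (f : fun0 M N) :
  difference_formula f F -> nc_order0 Omega f.
Proof.
move=> df n m X Y S OX OY SX; apply/eqP; rewrite eq_sym -subr_eq0 df //.
by rewrite SX subrr order1_0.
Qed.

Lemma Delta_of_difference_formula (f : fun0 M N) :
  difference_formula f F ->
  forall n m (X : 'M[M]_n) (Y : 'M[M]_m) (Z : 'M[M]_(n, m)),
    Omega X -> Omega Y -> Delta Omega f X Y Z = F X Y Z.
Proof.
move=> df n m X Y Z OX OY; have hf := difference_formula_order0 df.
have [r [s [rs OB]]] := hadm Z OX OY; have [_ _ Fr] := hF.
(* With [S = [I 0]] between [X] and the block point, the commutator is [[0 -rZ]]. It factors through
   [[0 I]], which intertwines the block point with [Y], so only [F X Y Z] survives. *)
have := df _ _ _ _ (row_mx 1%:M 0) OX OB; rewrite (DeltaE hadm hf OX OY rs OB).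
rewrite !block_mxEv !lmul_row_col !rmul_row !lmul0 !addr0 !lmul_scalar !rmul_scalar.
rewrite !rmul0 !mxscale1 !opp_row_mx !add_row_mx !subrr !sub0r -block_mxEv.
have -> : row_mx (0 : 'M[M]_n) (- (r *:m Z)) = (- (r *:m Z)) *mr row_mx 0 1%:M.
  by rewrite rmul_row rmul0 rmul_scalar mxscale1.
rewrite (Fr _ _ _ _ _ _ _ _ OX OB OY (block_row_intertwine X Y _)).
rewrite rmul_row rmul0 rmul_scalar mxscale1 order1N // order1Z //.
case/eq_row_mx => _ /oppr_inj e.
by rewrite [LHS](mxscale_eqr rs e) mxscaleA mulrC rs mxscale1.
Qed.

Lemma Delta0_eq_Delta1 (f : fun0 M N) :
  difference_formula f F ->
  forall n0 n1 n2 (X0 : 'M[M]_n0) (X1 : 'M[M]_n1) (X2 : 'M[M]_n2)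
    (Z1 : 'M[M]_(n0, n1)) (Z2 : 'M[M]_(n1, n2)),
    Omega X0 -> Omega X1 -> Omega X2 ->
    Delta0 Omega F X0 X1 X2 Z1 Z2 = Delta1 Omega F X0 X1 X2 Z1 Z2.
Proof.
move=> df n0 n1 n2 X0 X1 X2 Z1 Z2 O0 O1 O2; have [_ Fl Fr] := hF.
(* The two block points are rescaled independently, by [r] and [r']; [mxscale_cancel] reconciles the
   factors at the end. *)
have [r [s [rs OB]]] := hadm Z1 O0 O1; have [r' [s' [rs' OC]]] := hadm Z2 O1 O2.
rewrite (Delta0E hadm hF _ O0 O1 O2 rs OB) (Delta1E hadm hF _ O0 O1 O2 rs' OC).
rewrite row_mx10_lmul rmul_col_mx01.
have hf := difference_formula_order0 df.
(* For [S = [0 0; I 0]] the two copies of [X1] cancel, leaving [r Z1] and [-r' Z2] on the diagonal.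
   Each summand contains an intertwiner that reduces one of the two block points to a diagonal
   block. *)
have SE : block_mx X0 (r *:m Z1) 0 X1 *mr block_mx 0 0 1%:M 0 -
      block_mx 0 0 1%:M 0 *ml block_mx X1 (r' *:m Z2) 0 X2 =
    col_mx 1%:M 0 *ml (r *:m row_mx Z1 0) - (r' *:m col_mx 0 Z2) *mr row_mx 0 1%:M.
  rewrite rmul_block lmul_block mxscale_row mxscale_col lmul_col rmul_row
    !mxscale0 !rmul0 !lmul0 !(addr0, add0r) !lmul_scalar.
  rewrite !rmul_scalar !mxscale1 -[X in _ - row_mx X _]col_mx0 -block_mxEh.
  rewrite -[X in col_mx _ X]row_mx0 -block_mxEv !opp_block_mx !add_block_mx.
  by rewrite !subr0 !subrr !sub0r.
(* On the [f] side the upper right block is zero, while on the [F] side it is [r] times the block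
   defining [Delta1] minus [r'] times the one defining [Delta0]. *)
have := congr1 ursubmx (df _ _ _ _ (block_mx 0 0 1%:M 0) OB OC).
rewrite SE (order0_block hf O0 O1 OB) (order0_block hf O1 O2 OC).
rewrite rmul_block lmul_block !rmul0 !lmul0 !(addr0, add0r).
rewrite opp_block_mx add_block_mx subrr block_mxKur.
rewrite order1D // order1N //.
rewrite (Fr _ _ _ _ _ _ _ _ OB OC O2 (block_row_intertwine X1 X2 _)).
rewrite -(Fl _ _ _ _ _ _ _ _ O0 OB OC (block_col_intertwine X0 X1 _)).
rewrite !order1Z // lmul_col rmul_row lmul0 rmul0 lmul_scalar rmul_scalar !mxscale1.
set G := F X0 _ _; set H := F _ X2 _.
rewrite -{1}(hsubmxK G) -{1}(vsubmxK H) mxscale_row mxscale_col.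
rewrite -[X in col_mx _ X]row_mx0 -block_mxEv -[X in _ - row_mx X _]col_mx0 -block_mxEh.
rewrite opp_block_mx add_block_mx block_mxKur => /esym/eqP; rewrite subr_eq0 => /eqP e.
exact: mxscale_cancel rs rs' (esym e).
Qed.

Lemma order1_leibniz :
  (forall n0 n1 n2 (X0 : 'M[M]_n0) (X1 : 'M[M]_n1) (X2 : 'M[M]_n2)
      (Z1 : 'M[M]_(n0, n1)) (Z2 : 'M[M]_(n1, n2)),
      Omega X0 -> Omega X1 -> Omega X2 ->
      Delta0 Omega F X0 X1 X2 Z1 Z2 = Delta1 Omega F X0 X1 X2 Z1 Z2) ->
  forall n m p (X : 'M[M]_n) (Y : 'M[M]_m) (Z : 'M[M]_p)
    (S : 'M[R]_(n, m)) (T : 'M[R]_(m, p)), Omega X -> Omega Y -> Omega Z ->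
  F X Z (X *mr (S *m T) - (S *m T) *ml Z) =
  F X Y (X *mr S - S *ml Y) *mr T + S *ml F Y Z (Y *mr T - T *ml Z).
Proof.
move=> F01 n m p X Y Z S T OX OY OZ.
have := F01 _ _ _ X Y Z (X *mr S - S *ml Y) (Y *mr T - T *ml Z) OX OY OZ.
rewrite Delta0_commutator // Delta1_commutator // => /eqP.
rewrite subr_eq addrAC eq_sym subr_eq eq_sym -order1D // => /eqP <-.
(* The arguments telescope: [(XS - SY)T + S(YT - TZ) = XST - STZ]. *)
congr (F _ _ _); rewrite lmulmxDr rmulmxDl lmulmxNr rmulmxNl -rmulmxA -lmulmxA lrmulmxA.
by rewrite [RHS]addrC subrKA.
Qed.

Lemma order1_commutator_sum n m (X : 'M[M]_n) (Y : 'M[M]_m) k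
    (a : 'I_k -> R) (S : 'I_k -> 'M[R]_(n, m)) : Omega X -> Omega Y ->
  F X Y (X *mr (\sum_j a j *: S j) - (\sum_j a j *: S j) *ml Y) =
  \sum_j a j *:m F X Y (X *mr S j - S j *ml Y).
Proof.
move=> OX OY; pose D S := F X Y (X *mr S - S *ml Y); rewrite -/(D _).
rewrite (big_morph D (id1 := 0) (op1 := +%R)) => [|A B|].
- by apply: eq_bigr => j _; rewrite /D lmulmxZl rmulmxZr -mxscaleBr order1Z.
- by rewrite /D -order1D // rmulmxDr lmulmxDl opprD addrACA.
- by rewrite /D rmul0 lmul0 subrr order1_0.
Qed.

(** Column [j] is column [ord0] of the derivation at the matrix unit [delta_mx j ord0]. The size
    [m.+1] of the base point supplies the index [ord0]. *)
Definition antiderivative m (Y : 'M[M]_m.+1) : fun0 M N := fun n X =>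
  \matrix_(i, j) F X Y (X *mr delta_mx j ord0 - delta_mx j ord0 *ml Y) i ord0.

Lemma antiderivative_difference m (Y : 'M[M]_m.+1) : Omega Y ->
  (forall n0 n1 n2 (X0 : 'M[M]_n0) (X1 : 'M[M]_n1) (X2 : 'M[M]_n2)
      (Z1 : 'M[M]_(n0, n1)) (Z2 : 'M[M]_(n1, n2)),
      Omega X0 -> Omega X1 -> Omega X2 ->
      Delta0 Omega F X0 X1 X2 Z1 Z2 = Delta1 Omega F X0 X1 X2 Z1 Z2) ->
  difference_formula (antiderivative Y) F.
Proof.
move=> OY F01 n n' X X' S OX OX'; apply/matrixP => i k.
(* The Leibniz rule for the points [X], [X'], [Y] with [T = delta_mx k ord0], read in column [ord0]:
   multiplication by [T] moves column [k] there, and [S *m T] expands into the matrix units that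
   define the antiderivative. *)
have /matrixP/(_ i ord0) := order1_leibniz F01 S (delta_mx k (ord0 : 'I_m.+1)) OX OX' OY.
rewrite mulmx_delta order1_commutator_sum // summxE [RHS]mxE rmul_delta => e.
rewrite mxBE; apply/eqP; rewrite subr_eq; apply/eqP.
transitivity (\sum_j S j k *:
    F X Y (X *mr delta_mx j ord0 - delta_mx j ord0 *ml Y) i ord0).
  by rewrite mxE; apply: eq_bigr => j _; rewrite mxE.
have -> : (S *ml antiderivative Y X') i k =
    (S *ml F X' Y (X' *mr delta_mx k ord0 - delta_mx k ord0 *ml Y)) i ord0.
  by rewrite !mxE; apply: eq_bigr => j _; rewrite mxE.
by rewrite -e; apply: eq_bigr => j _; rewrite mxE.
Qed.

(** Subtracting the two formulas, [g = f' - f] satisfies [g(X) E = E g(Y)] for every matrix unit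
    [E = delta_mx j ord0]. Column [ord0] then shows that column [j] of [g(X)] is the corner entry of
    [g(Y)] in row [j] and zero elsewhere. *)
Lemma difference_formula_unique (f f' : fun0 M N) m (Y : 'M[M]_m.+1) :
  Omega Y -> difference_formula f F -> difference_formula f' F ->
  forall n (X : 'M[M]_n), Omega X ->
    f' n X = f n X + scalar_mx (f' _ Y ord0 ord0 - f _ Y ord0 ord0).
Proof.
move=> OY df df' n X OX; apply/matrixP => i j.
have := df' _ _ _ _ (delta_mx j ord0) OX OY; rewrite -df // => /matrixP/(_ i ord0).
rewrite !mxBE !rmul_delta !lmul_delta => /eqP.
rewrite subr_eq => /eqP ->.
by rewrite -addrA !mxE mulrnBl eq_sym [RHS]addrC [in RHS]addrC [- _ + _]addrC.
Qed.

End Integration.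

Theorem theorem1p1 (R : comPzRingType) (M N : lmodType R)
    (Omega : forall n, set 'M[M]_n) (F : fun1 M N)
    (hOmega : nc_set Omega) (hadm : right_admissible Omega)
    (hF : nc_order1 Omega F) :
  ((exists f : fun0 M N, nc_order0 Omega f /\
      forall n m (X : 'M[M]_n) (Y : 'M[M]_m) (Z : 'M[M]_(n, m)),
        Omega n X -> Omega m Y -> Delta Omega f X Y Z = F n m X Y Z)
   <->
   (forall n0 n1 n2 (X0 : 'M[M]_n0) (X1 : 'M[M]_n1) (X2 : 'M[M]_n2)
      (Z1 : 'M[M]_(n0, n1)) (Z2 : 'M[M]_(n1, n2)),
      Omega n0 X0 -> Omega n1 X1 -> Omega n2 X2 ->
      Delta0 Omega F X0 X1 X2 Z1 Z2 = Delta1 Omega F X0 X1 X2 Z1 Z2))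
  /\
  (forall f f' : fun0 M N,
     nc_order0 Omega f -> nc_order0 Omega f' ->
     (forall n m (X : 'M[M]_n) (Y : 'M[M]_m) (Z : 'M[M]_(n, m)),
        Omega n X -> Omega m Y -> Delta Omega f X Y Z = F n m X Y Z) ->
     (forall n m (X : 'M[M]_n) (Y : 'M[M]_m) (Z : 'M[M]_(n, m)),
        Omega n X -> Omega m Y -> Delta Omega f' X Y Z = F n m X Y Z) ->
     exists c : N, forall n (X : 'M[M]_n),
       Omega n X -> f' n X = f n X + scalar_mx c).

Proof.
(* The construction needs a base point of positive size: [nc_set] excludes level zero, so either one
   exists or [Omega] is empty at every level. *)
have base : (exists m (Y : 'M[M]_m.+1), Omega _ Y) \/ forall n (X : 'M[M]_n), ~ Omega n X.
  case: (pselect (exists m (Y : 'M[M]_m.+1), Omega _ Y)) => [|noY]; first by left.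
  right=> -[X|n X OX]; first by rewrite hOmega.1.
  by apply: noY; exists n, X.
split; first split.
- case=> f [hf fF] n0 n1 n2 X0 X1 X2 Z1 Z2.
  exact: (Delta0_eq_Delta1 hadm hF (difference_formula_Delta hadm hf fF)).
- move=> F01; case: base => [[m [Y OY]]|empty]; last first.
    (* Over an empty [Omega] all conditions are vacuous, so the zero function serves. *)
    by exists (fun n _ => 0); split=> [n m X Y S /empty|n m X Y Z /empty].
  have df := antiderivative_difference hadm hF OY F01.
  exists (antiderivative F Y); split; first exact: (difference_formula_order0 hF df).
  exact: (Delta_of_difference_formula hadm hF df).
- move=> f f' hf hf' fF f'F; case: base => [[m [Y OY]]|empty]; last first.
    by exists 0 => n X /empty.
  exists (f' _ Y ord0 ord0 - f _ Y ord0 ord0).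
  exact: (difference_formula_unique OY (difference_formula_Delta hadm hf fF)
                                       (difference_formula_Delta hadm hf' f'F)).
Qed.
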